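(* Let $d\ge2$ and $m\ge1$ be integers and put $M=(d-1)m$, $K=(d-1)(m-1)$, $L=(d-2)(m-1)$. Let $$H_L(x)=\frac{(3+x)_{m-1}(4+x)_{m-1}\cdots(d+x)_{m-1}}{(3)_{m-1}(4)_{m-1}\cdots(d)_{m-1}}$$ (with $H_L\equiv1$ if $d=2$) and $\hat{Q}_L=\hat{T}_L(m+1,m+d;2)H_L$, where $\hat{T}_L(m+1,m+d;2)$ is the second Miller–Paris operator. Then the $d$-Narayana polynomial $N_{d,m}$ is given by $$N_{d,m}(x)=\frac{1}{K+1}\sum_{j=0}^{K}\binom{M}{j}\binom{K+1}{j+1}\hat{Q}_L(j)\,x^j .$$ In particular, $\hat{Q}_L$ can be found by the formula $$\hat{Q}_L(t)=\sum_{j=0}^{L}\frac{(m+d)_j\,(-K-2)_j\,(-t)_j\,(t-M)_{L-j}}{(-1)^j(-M)_L(-K)_j\,j!}\;{}_dF_{d-1}\!\left(\begin{array}{c}-j,\,m+1,\,m+2,\ldots,m+d-1\\ K+3-j,\,3,\,4,\ldots,d\end{array}\Big|\,1\right).$$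
   Context: $(b)_n=b(b+1)\cdots(b+n-1)$, $(b)_0=1$, is the Pochhammer symbol, and ${}_pF_q\!\left(\begin{array}{c}a_1,\ldots,a_p\\ b_1,\ldots,b_q\end{array}\Big|\,x\right)=\sum_{n\ge0}\frac{(a_1)_n\cdots(a_p)_n}{(b_1)_n\cdots(b_q)_n\,n!}x^n$ is the generalized hypergeometric function. The $d$-Narayana polynomial $N_{d,m}$ is the polynomial defined by the generating relation $${}_dF_{d-1}\!\left(\begin{array}{c}m+1,m+2,\ldots,m+d\\2,3,\ldots,d\end{array}\Big|\,x\right)=\frac{N_{d,m}(x)}{(1-x)^{md+1}} .$$ Miller–Paris operators: for an integer $\omega\ge0$ and parameters with $(\rho-\epsilon-\omega)_\omega\ne0$, the first Miller–Paris operator $T_\omega(\epsilon;\rho)$ acts on polynomials $H$ of degree at most $\omega$ by $$[T_\omega(\epsilon;\rho)H](t)=\frac{1}{(\rho-\epsilon-\omega)_\omega}\sum_{k=0}^{\omega}\frac{(-1)^k(\epsilon)_k(-t)_k(\rho-\epsilon-\omega+t)_{\omega-k}}{k!}\sum_{j=0}^{k}\frac{(-k)_j}{j!}H(j).$$ If moreover $(\rho-\delta-\omega)_\omega\ne0$, the second Miller–Paris operator is $\hat{T}_\omega(\delta,\epsilon;\rho)=T_\omega(\delta;\rho)\,T_\omega(\epsilon;\rho)$ (composition). It is the map $H\mapsto\hat{Q}$ in the generalized Euler transformation $$\sum_{n\ge0}\frac{(\delta)_n(\epsilon)_n}{(\rho)_n n!}H(n)x^n=(1-x)^{\rho-\delta-\epsilon-\omega}\sum_{n\ge0}\frac{(\rho-\delta-\omega)_n(\rho-\epsilon-\omega)_n}{(\rho)_n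 n!}\hat{Q}(n)x^n .$$ *)

(* Defs.v *)
From HB Require Import structures.
From mathcomp Require Import all_boot all_order all_algebra.
From mathcomp Require Import all_classical all_reals all_analysis.

Set Implicit Arguments.
Unset Strict Implicit.
Unset Printing Implicit Defensive.

Import Order.TTheory GRing.Theory Num.Theory.
Import numFieldNormedType.Exports.

Local Open Scope ring_scope.

(* Stated over any ring so that it also applies to polynomials in 'X. *)
Definition pochhammer (A : pzRingType) (b : A) (n : nat) : A :=
  \prod_(i < n) (b + i%:R).

Section Hypergeometric.
Variable R : realType.

(* Meaningful only if no lower parameter is 0, -1, ..., -(n-1). *)
Definition hyper_coef (a b : seq R) (n : nat) : R :=
  (\prod_(c <- a) pochhammer c n) / ((\prod_(c <- b) pochhammer c n) * n`!%:R).

(* Sum of the series; junk value if it diverges. *)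
Definition hypergeometric (a b : seq R) (x : R) : R :=
  limn (series (fun n : nat => hyper_coef a b n * x ^+ n)).

Definition is_narayana (d m : nat) (N : {poly R}) : Prop :=
  forall x : R, `|x| < 1 ->
    hypergeometric [seq (m + i)%:R | i <- iota 1 d]
                   [seq i%:R | i <- iota 2 d.-1] x
    = N.[x] / (1 - x) ^+ (m * d + 1).

End Hypergeometric.

Section MillerParis.
Variable F : fieldType.

(* The variable t of the image polynomial is 'X, see miller_paris1_horner.
   Meaningful for size H <= w.+1 and pochhammer (rho - eps - w%:R) w != 0. *)
Definition miller_paris1 (w : nat) (eps rho : F) (H : {poly F}) : {poly F} :=
  (pochhammer (rho - eps - w%:R) w)^-1 *:
  \sum_(k < w.+1)
    ((-1) ^+ k * pochhammer eps k / k`!%:R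
      * (\sum_(j < k.+1) pochhammer (- k%:R) j / j`!%:R * H.[j%:R]))
    *: (pochhammer (- 'X) k
        * pochhammer ((rho - eps - w%:R)%:P + 'X) (w - k)).

Definition miller_paris2 (w : nat) (delta eps rho : F) (H : {poly F}) :
    {poly F} :=
  miller_paris1 w delta rho (miller_paris1 w eps rho H).

Lemma horner_pochhammer (p : {poly F}) (n : nat) (t : F) :
  (pochhammer p n).[t] = pochhammer p.[t] n.
Proof.
rewrite /pochhammer horner_prod; apply: eq_bigr => i _.
by rewrite hornerD -polyC_natr hornerC.
Qed.

Lemma miller_paris1_horner (w : nat) (eps rho : F) (H : {poly F}) (t : F) :
  (miller_paris1 w eps rho H).[t] =
  (pochhammer (rho - eps - w%:R) w)^-1 *
  \sum_(k < w.+1)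
    ((-1) ^+ k * pochhammer eps k * pochhammer (- t) k
      * pochhammer (rho - eps - w%:R + t) (w - k)) / k`!%:R
    * \sum_(j < k.+1) pochhammer (- k%:R) j / j`!%:R * H.[j%:R].
Proof.
rewrite /miller_paris1 hornerZ horner_sum; congr (_ * _).
apply: eq_bigr => k _.
rewrite hornerZ hornerM !horner_pochhammer hornerN hornerX hornerD hornerC.
rewrite hornerX; set S := \sum_(j < _) _; set p := pochhammer _ (w - k).
by rewrite mulrAC; congr (_ * S);
  rewrite -!mulrA; congr (_ * (_ * _)); rewrite mulrC mulrA.
Qed.

(* For d = 2 both products are empty and the polynomial is 1. *)
Definition narayana_H (d m : nat) : {poly F} :=
  (\prod_(3 <= i < d.+1) pochhammer (i%:R : F) m.-1)^-1 *:
  \prod_(3 <= i < d.+1) pochhammer ((i%:R : F)%:P + 'X) m.-1.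

End MillerParis.

(* Main.v *)
Require Import Defs.
From HB Require Import structures.
From mathcomp Require Import all_boot all_order all_algebra.
From mathcomp Require Import all_classical all_reals all_analysis.
From mathcomp Require Import ring zify.

Import Order.TTheory GRing.Theory Num.Theory.
Import numFieldNormedType.Exports.

Local Open Scope ring_scope.

Set Implicit Arguments.
Unset Strict Implicit.
Unset Printing Implicit Defensive.

(** Everything rests on the binomial transform
    [(B f) n = \sum_(k <= n) (-1) ^+ k * 'C(n, k) * f k], an involution on
    sequences. Write [(b)_n] for [pochhammer b n].

    The first operator [T_w(eps; rho)] is the binomial transform seen through
    Pochhammer weights: with [lam = rho - eps - w], a polynomial [H] of degree
    at most [w] satisfies
    [(lam)_n / (rho)_n * (T_w(eps; rho) H)(n) = B ((eps)_k / (rho)_k * H(k)) n]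
    ([miller_paris1_transform]). Indeed, expand [H] in the Newton basis
    ['C(k, j)], whose coefficients are, up to sign, the values of [B H], and
    sum over [k] by the Chu-Vandermonde formula.

    Suppose that [delta = a + 1] and [rho - eps - w = - M] for naturals [a]
    and [M]. Since [B] is an involution, the factor [(eps)_n / (rho)_n * H(n)]
    of the n-th coefficient of the series is a transform of a sequence that
    vanishes beyond [M]. Summing the series
    [\sum_n 'C(n + a, a + k) * x ^+ n = x ^+ k / (1 - x) ^+ (a + k + 1)]
    over finitely many [k] puts the whole over the denominator
    [(1 - x) ^+ (a + 1 + M)]. The numerator is written in the Bernstein basis
    ['C(M, k) * x ^+ k * (1 - x) ^+ (M - k)], with coefficients which are again
    a binomial transform, namely that of the values of
    [T_w(delta; rho) (T_w(eps; rho) H)] with their Pochhammer weights; hence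
    these weighted values give, up to sign and a factor ['C(M, l)], its
    coefficients in the monomial basis ([euler_transformation]). For the
    parameters of the theorem this is the formula for the d-Narayana
    polynomial, which is the only polynomial satisfying the defining relation
    because two polynomials which agree on the open unit ball are equal.

    The transformation may be applied with the two upper parameters
    [m + 1] and [m + d] in either order. Both applications have the same
    left-hand side, so the two first operators commute on the given [H]
    ([narayana_miller_paris2C]). The explicit formula for the polynomial [Q]
    is then the definition of the outer operator [T_L(m + d; 2)] applied to
    [G = T_L(m + 1; 2) H], once [B G] is computed by a second use of
    Chu-Vandermonde ([transform_miller_paris1]). *)

(** * Pochhammer symbols and binomial coefficients *)

Section Poch.
Variable A : comPzRingType.
Implicit Types b : A.

Lemma pochhammer0 b : pochhammer b 0 = 1.
Proof. by rewrite /pochhammer big_ord0. Qed.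

Lemma pochhammerSr b n : pochhammer b n.+1 = pochhammer b n * (b + n%:R).
Proof. by rewrite /pochhammer big_ord_recr. Qed.

Lemma pochhammerD b n k :
  pochhammer b (n + k) = pochhammer b n * pochhammer (b + n%:R) k.
Proof.
rewrite /pochhammer big_split_ord /=; congr (_ * _).
by apply: eq_bigr => i _; rewrite natrD addrA.
Qed.

Lemma pochhammerSl b n : pochhammer b n.+1 = b * pochhammer (b + 1) n.
Proof. by rewrite -add1n pochhammerD pochhammerSr pochhammer0 mul1r addr0. Qed.

Lemma pochhammerN n k :
  pochhammer (- n%:R : A) k = (-1) ^+ k * 'C(n, k)%:R * k`!%:R.
Proof.
rewrite -mulrA -natrM bin_ffact.
elim: k => [|k IHk]; first by rewrite pochhammer0 expr0 ffactn0 mul1r.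
rewrite pochhammerSr IHk ffactnSr natrM exprS.
have [lenk|ltnk] := leqP n k; last by rewrite natrB 1?ltnW //; ring.
have -> : (n - k)%:R = 0 :> A by rewrite (eqP (_ : n - k == 0)%N).
rewrite !mulr0; move: lenk; rewrite leq_eqVlt => /orP[/eqP->|ltnk].
  by rewrite addNr mulr0.
by rewrite ffact_small // mulr0 mul0r.
Qed.

Lemma pochhammer_natS a n :
  pochhammer (a.+1%:R : A) n = 'C(n + a, a)%:R * n`!%:R.
Proof.
rewrite -natrM; elim: n => [|n IHn]; first by rewrite pochhammer0 binn.
rewrite pochhammerSr IHn -natrD -natrM; congr (_%:R).
apply/eqP; rewrite -(eqn_pmul2r (fact_gt0 a)); apply/eqP.
rewrite -mulnA [LHS]mulnC.
rewrite addSn factS.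
have := bin_fact (leq_addl n a); have := bin_fact (leq_addl n.+1 a).
rewrite addSn -[in (_ - a)%N]addSn !addnK factS [((n+a).+1)`!]factS. nia.
Qed.

Lemma pochhammer_reflect b n :
  pochhammer b n = (-1) ^+ n * pochhammer (1 - b - n%:R) n.
Proof.
elim: n b => [|n IHn] b; first by rewrite !pochhammer0 mul1r.
rewrite pochhammerSl IHn pochhammerSr exprS -natr1.
rewrite (_ : 1 - (b + 1) - n%:R = 1 - b - (n%:R + 1)); last by ring.
by rewrite (_ : 1 - b - (n%:R + 1) + n%:R = - b); [ring|ring].
Qed.

End Poch.

Lemma pochhammer_neq0_le (F : fieldType) (b : F) k n : (k <= n)%N ->
  pochhammer b n != 0 -> pochhammer b k != 0.
Proof. by move=> /subnKC <-; rewrite pochhammerD mulf_eq0 negb_or => /andP[]. Qed.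

Lemma pochhammer_gt0 (R : numDomainType) (b : R) n : 0 < b -> 0 < pochhammer b n.
Proof. by move=> b0; apply: prodr_gt0 => i _; rewrite ltr_wpDr. Qed.

Lemma pochhammerN_neq0 (R : numFieldType) n k :
  (pochhammer (- n%:R : R) k != 0) = (k <= n)%N.
Proof.
rewrite pochhammerN !mulf_eq0 !negb_or signr_eq0 !pnatr_eq0 -!lt0n.
by rewrite bin_gt0 fact_gt0 andbT.
Qed.

Lemma bin_trinomial n i j : (j <= n)%N ->
  ('C(n, i + j) * 'C(i + j, j) = 'C(n, j) * 'C(n - j, i))%N.
Proof.
move=> lejn; have [leij|ltij] := leqP (i + j) n; last first.
  by rewrite (bin_small ltij) (@bin_small (n - j)) ?muln0 // ltn_subLR // addnC.
apply/eqP; rewrite -(eqn_pmul2r (fact_gt0 i)) -(eqn_pmul2r (fact_gt0 j)).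
rewrite -(eqn_pmul2r (fact_gt0 (n - (i + j)))); apply/eqP.
have e1 := bin_fact leij; have e2 := bin_fact (leq_addl i j).
have e3 := bin_fact lejn.
have lein : (i <= n - j)%N by rewrite leq_subRL // addnC.
have := bin_fact lein; rewrite -subnDA (addnC j i) => e4.
move: e1 e2 e3 e4; rewrite addnK. nia.
Qed.

(** * The binomial transform *)

Section BinomialTransform.
Variable F : comPzRingType.
Implicit Types f g : nat -> F.

(** The alternating transform of a sequence. Only the values [f 0], ..., [f n]
    enter [binomial_transform f n]. *)
Definition binomial_transform f n : F :=
  \sum_(k < n.+1) (-1) ^+ k * 'C(n, k)%:R * f k.

Local Notation B := binomial_transform.

Lemma binomial_transform_widen N f n : (n < N)%N ->
  B f n = \sum_(k < N) (-1) ^+ k * 'C(n, k)%:R * f k.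
Proof.
move=> ltnN; rewrite /B.
rewrite (big_ord_widen N (fun k => (-1) ^+ k * 'C(n, k)%:R * f k)) //.
rewrite big_mkcond; apply: eq_bigr => i _; case: ltnP => // ni.
by rewrite bin_small // mulr0 mul0r.
Qed.

Lemma eq_binomial_transform f g n :
  (forall k, (k <= n)%N -> f k = g k) -> B f n = B g n.
Proof. by move=> fg; apply: eq_bigr => k _; rewrite fg // -ltnS. Qed.

Lemma binomial_transformB f g n : B (fun k => f k - g k) n = B f n - B g n.
Proof. by rewrite /B -sumrB; apply: eq_bigr => k _; rewrite mulrBr. Qed.

Lemma binomial_transformZ c f n : B (fun k => c * f k) n = c * B f n.
Proof. by rewrite /B mulr_sumr; apply: eq_bigr => k _; ring. Qed.

Lemma binomial_transform_sum (I : finType) (f : I -> nat -> F) n :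
  B (fun k => \sum_i f i k) n = \sum_i B (f i) n.
Proof. by rewrite /B exchange_big; apply: eq_bigr => k _; rewrite mulr_sumr. Qed.

(** In operator form, [(B f) (n + 1) = (B (1 - E) f) n] with [E] the shift. *)
Lemma binomial_transformS f n : B f n.+1 = B f n - B (fun k => f k.+1) n.
Proof.
rewrite (@binomial_transform_widen n.+2 f n) // {1}/B.
rewrite !(big_ord_recl n.+1) /= !bin0.
rewrite -addrA; congr (_ + _); rewrite /B -sumrB; apply: eq_bigr => k _.
by rewrite /bump /= add1n binS natrD exprS; ring.
Qed.

Lemma binomial_transformK f n : B (B f) n = f n.
Proof.
elim: n f => [|n IHn] f.
  by rewrite /B !big_ord1 !bin0 expr0 !mul1r.
rewrite binomial_transformS.
under [X in _ - X]eq_binomial_transform => k _ do rewrite binomial_transformS.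
by rewrite binomial_transformB opprB addrCA subrr addr0 IHn.
Qed.

Lemma binomial_transform_bin g j n : (j <= n)%N ->
  B (fun k => 'C(k, j)%:R * g k) n =
  (-1) ^+ j * 'C(n, j)%:R * B (fun i => g (i + j)%N) (n - j).
Proof.
move=> lejn; rewrite /B mulr_sumr -(big_mkord xpredT (fun k : nat =>
  (-1) ^+ k * 'C(n, k)%:R * ('C(k, j)%:R * g k))).
rewrite (big_cat_nat (n := j)) ?leqW //= big1_seq ?add0r; last first.
  move=> k /andP[_]; rewrite mem_index_iota => /andP[_ ?].
  by rewrite (bin_small (n := k)) // mul0r mulr0.
rewrite -{1}[j]add0n big_addn subSn // big_mkord; apply: eq_bigr => i _.
have e : 'C(n, i + j)%:R * 'C(i + j, j)%:R = 'C(n, j)%:R * 'C(n - j, i)%:R :> F.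
  by rewrite -!natrM bin_trinomial.
by rewrite exprD -2!mulrA (mulrA 'C(n, _)%:R) e; ring.
Qed.

End BinomialTransform.

(** * The first Miller-Paris operator as a binomial transform *)

Section MillerParisTransform.
Variable F : numFieldType.
Local Notation B := (@binomial_transform F).

(** The n-th difference of a polynomial of degree less than [n] is zero. *)
Lemma binomial_transform_poly (H : {poly F}) n : (size H <= n)%N ->
  B (fun k => H.[k%:R]) n = 0.
Proof.
elim: n H => [|n IHn] H sH.
  move: sH; rewrite leqn0 size_poly_eq0 => /eqP->.
  by rewrite /B big1 // => k _; rewrite horner0 mulr0.
have [->|H0] := eqVneq H 0.
  by rewrite /B big1 // => k _; rewrite horner0 mulr0.
have [s sHE] : {s | size H = s.+1}.
  by exists (size H).-1; rewrite prednK // lt0n size_poly_eq0.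
(* Taylor expansion of H at k + 1 around k. *)
have -> : B (fun k => H.[k%:R]) n.+1 =
          - B (fun k => \sum_(i < s) H^`N(i.+1).[k%:R]) n.
  rewrite binomial_transformS -binomial_transformB -mulN1r -binomial_transformZ.
  apply: eq_binomial_transform => k _.
  rewrite -natr1 nderiv_taylor; last exact: mulrC.
  rewrite sHE big_ord_recl nderivn0 expr0 mulr1 opprD addrA subrr add0r mulN1r.
  by congr (- _); apply: eq_bigr => i _; rewrite expr1n mulr1.
rewrite binomial_transform_sum big1 ?oppr0 // => i _; apply: IHn.
by apply: leq_trans (size_poly _ _) _; move: sH; rewrite sHE; lia.
Qed.

Implicit Types (eps rho lam : F) (H : {poly F}).

(** Newton's interpolation formula at the naturals. *)
Lemma poly_newton w H k : (size H <= w.+1)%N ->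
  H.[k%:R] = \sum_(j < w.+1) (-1) ^+ j * 'C(k, j)%:R * B (fun i => H.[i%:R]) j.
Proof.
move=> sH; rewrite -[LHS](binomial_transformK (fun i => H.[i%:R])).
rewrite (@binomial_transform_widen _ (w.+1 + k)) 1?addSn ?ltnS ?leq_addl //.
rewrite -addSn big_split_ord /= [X in _ + X]big1 ?addr0 // => i _.
by rewrite binomial_transform_poly ?mulr0 // (leq_trans sH) // leq_addr.
Qed.

(** Chu-Vandermonde: the left-hand side is the terminating Gauss series with
    upper parameters [- n], [eps] and lower parameter [rho] at 1. *)
Lemma chu_vandermonde eps rho n : pochhammer rho n != 0 ->
  B (fun k => pochhammer eps k / pochhammer rho k) n =
  pochhammer (rho - eps) n / pochhammer rho n.
Proof.
elim: n eps rho => [|n IHn] eps rho rho0.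
  by rewrite /binomial_transform big_ord1 !bin0 expr0 !mul1r !pochhammer0.
have rhon := pochhammer_neq0_le (leqnSn n) rho0.
have /andP[r0 r1n] : (rho != 0) && (pochhammer (rho + 1) n != 0).
  by rewrite -negb_or -mulf_eq0 -pochhammerSl.
have rn : rho + n%:R != 0.
  by apply: contraNneq rho0 => e; rewrite pochhammerSr e mulr0.
rewrite binomial_transformS IHn //.
have -> : B (fun k => pochhammer eps k.+1 / pochhammer rho k.+1) n =
    eps / rho * B (fun k => pochhammer (eps + 1) k / pochhammer (rho + 1) k) n.
  rewrite -binomial_transformZ; apply: eq_binomial_transform => k _.
  by rewrite !pochhammerSl invfM; ring.
rewrite IHn // (_ : rho + 1 - (eps + 1) = rho - eps); last by ring.
have e : rho * pochhammer (rho + 1) n = pochhammer rho n * (rho + n%:R).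
  by rewrite -pochhammerSl pochhammerSr.
have -> : eps / rho * (pochhammer (rho - eps) n / pochhammer (rho + 1) n) =
   eps * pochhammer (rho - eps) n / (pochhammer rho n * (rho + n%:R)).
  by rewrite -e; field; rewrite r0 r1n.
by rewrite !pochhammerSr; field; rewrite rhon rn.
Qed.

(** The previous formula with its summation starting at [j]: the weight
    ['C(k, j)] shifts both parameters by [j]. *)
Lemma chu_vandermonde_bin eps rho n j : pochhammer rho n != 0 ->
  B (fun k => 'C(k, j)%:R * (pochhammer eps k / pochhammer rho k)) n =
  (-1) ^+ j * 'C(n, j)%:R * (pochhammer eps j * pochhammer (rho - eps) (n - j)
    / pochhammer rho n).
Proof.
move=> rho0; have [lejn|ltnj] := leqP j n; last first.
  rewrite bin_small // mulr0 mul0r /binomial_transform big1 // => k _.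
  by rewrite (@bin_small k) ?mul0r ?mulr0 // (leq_trans (ltn_ord k)).
rewrite binomial_transform_bin //; congr (_ * _).
have e : pochhammer rho n = pochhammer rho j * pochhammer (rho + j%:R) (n - j).
  by rewrite -pochhammerD subnKC.
have /andP[rj rnj] :
    (pochhammer rho j != 0) && (pochhammer (rho + j%:R) (n - j) != 0).
  by rewrite -negb_or -mulf_eq0 -e.
have -> : B (fun i => pochhammer eps (i + j) / pochhammer rho (i + j)) (n - j) =
  pochhammer eps j / pochhammer rho j *
  B (fun i => pochhammer (eps + j%:R) i / pochhammer (rho + j%:R) i) (n - j).
  rewrite -binomial_transformZ; apply: eq_binomial_transform => k _.
  by rewrite ![(k + j)%N]addnC !pochhammerD invfM; ring.
rewrite chu_vandermonde //.
rewrite (_ : rho + j%:R - (eps + j%:R) = rho - eps); last by ring.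
by rewrite e invfM; ring.
Qed.

Lemma size_pochhammer (p : {poly F}) n : (size p <= 2)%N ->
  (size (pochhammer p n) <= n.+1)%N.
Proof.
move=> sp; elim: n => [|n IHn]; first by rewrite pochhammer0 size_poly1.
rewrite pochhammerSr (leq_trans (size_polyMleq _ _)) //.
have : (size (p + n%:R)%R <= 2)%N.
  rewrite -polyC_natr (leq_trans (size_polyD _ _)) // geq_max sp size_polyC.
  by case: eqP.
by move: IHn; set a := size _; set b := size _; lia.
Qed.

Lemma size_miller_paris1 w eps rho H :
  (size (miller_paris1 w eps rho H) <= w.+1)%N.
Proof.
rewrite /miller_paris1 (leq_trans (size_scale_leq _ _)) //.
apply: (leq_trans (size_sum _ _ _)); apply/bigmax_leqP => k _.
apply: (leq_trans (size_scale_leq _ _)); apply: (leq_trans (size_polyMleq _ _)).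
have : (size (pochhammer (- 'X : {poly F})%R k) <= k.+1)%N.
  by apply: size_pochhammer; rewrite size_polyN size_polyX.
have : (size (pochhammer ((rho - eps - w%:R)%:P + 'X)%R (w - k))
        <= (w - k).+1)%N.
  by apply: size_pochhammer; rewrite addrC size_XaddC.
by have := ltn_ord k; set a := size _; set b := size _; lia.
Qed.

Lemma miller_paris1_sum w eps rho H t :
  (miller_paris1 w eps rho H).[t] =
  \sum_(k < w.+1) (-1) ^+ k * pochhammer eps k * pochhammer (- t) k
     * pochhammer (rho - eps - w%:R + t) (w - k)
     / (k`!%:R * pochhammer (rho - eps - w%:R) w)
     * B (fun i => H.[i%:R]) k.
Proof.
rewrite miller_paris1_horner mulr_sumr; apply: eq_bigr => k _.
rewrite invfM; have -> : B (fun i => H.[i%:R]) k =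
   \sum_(j < k.+1) pochhammer (- k%:R) j / j`!%:R * H.[j%:R].
  apply: eq_bigr => j _; congr (_ * _); by rewrite pochhammerN mulfK.
by ring.
Qed.

(** The characterization of the first Miller-Paris operator: up to Pochhammer
    weights, its values at the naturals are a binomial transform. *)
Lemma miller_paris1_transform w eps rho H n : (size H <= w.+1)%N ->
  pochhammer (rho - eps - w%:R) w != 0 -> pochhammer rho n != 0 ->
  pochhammer (rho - eps - w%:R) n / pochhammer rho n *
    (miller_paris1 w eps rho H).[n%:R] =
  B (fun k => pochhammer eps k / pochhammer rho k * H.[k%:R]) n.
Proof.
set lam := rho - eps - w%:R => sH lam0 rho0.
transitivity (B (fun k => \sum_(j < w.+1) (-1) ^+ j * B (fun i => H.[i%:R]) j *
   ('C(k, j)%:R * (pochhammer eps k / pochhammer rho k))) n); last first.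
  apply: eq_binomial_transform => k _; rewrite (poly_newton _ sH) mulr_sumr.
  by apply: eq_bigr => j _; ring.
rewrite binomial_transform_sum miller_paris1_sum mulr_sumr; apply: eq_bigr => j _.
rewrite binomial_transformZ chu_vandermonde_bin // -/lam.
have [lejn|ltnj] := leqP j n; last first.
  by rewrite pochhammerN bin_small //; ring.
have lejw : (j <= w)%N by rewrite -ltnS.
have e : pochhammer lam n * pochhammer (lam + n%:R) (w - j) =
         pochhammer lam w * pochhammer (rho - eps) (n - j).
  have -> : rho - eps = lam + w%:R by rewrite /lam; ring.
  rewrite -!pochhammerD.
  by congr pochhammer; lia.
rewrite pochhammerN.
transitivity (pochhammer lam w * pochhammer (rho - eps) (n - j) *
  ((-1) ^+ j * pochhammer eps j * ((-1) ^+ j * 'C(n, j)%:R)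
   * B (fun i => H.[i%:R]) j / (pochhammer lam w * pochhammer rho n))).
  rewrite -e; field; rewrite rho0 lam0 pnatr_eq0 -lt0n fact_gt0; exact: isT.
by field; rewrite rho0 lam0.
Qed.

(** The transform of the image polynomial. Its values are themselves a weighted
    transform of those of [H], and Chu-Vandermonde sums the kernel of the
    composite. The second parameter is [lam - rho = - eps - w]. *)
Lemma transform_miller_paris1 w eps rho H n : (size H <= w.+1)%N ->
  pochhammer (rho - eps - w%:R) w != 0 -> 
  pochhammer (rho - eps - w%:R) n != 0 -> pochhammer rho n != 0 ->
  B (fun k => (miller_paris1 w eps rho H).[k%:R]) n =
  \sum_(i < n.+1) 'C(n, i)%:R * pochhammer eps i *
    pochhammer (- eps - w%:R) (n - i) / pochhammer (rho - eps - w%:R) n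
    * H.[i%:R].
Proof.
set lam := rho - eps - w%:R => sH lam0 lamn rhon.
set g := fun i => pochhammer eps i / pochhammer rho i * H.[i%:R].
transitivity (B (fun k => \sum_(i < n.+1) (-1) ^+ i * g i *
   ('C(k, i)%:R * (pochhammer rho k / pochhammer lam k))) n).
  apply: eq_binomial_transform => k lekn.
  have rhok := pochhammer_neq0_le lekn rhon.
  have lamk := pochhammer_neq0_le lekn lamn.
  transitivity (pochhammer rho k / pochhammer lam k * B g k).
    by rewrite -(@miller_paris1_transform w) // -/lam; field; rewrite lamk rhok.
  rewrite (@binomial_transform_widen _ n.+1) ?ltnS // mulr_sumr.
  by apply: eq_bigr => i _; ring.
rewrite binomial_transform_sum; apply: eq_bigr => i _.
rewrite binomial_transformZ chu_vandermonde_bin // /g.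
rewrite (_ : lam - rho = - eps - w%:R); last by rewrite /lam; ring.
have rhoi : pochhammer rho i != 0.
  by apply: pochhammer_neq0_le rhon; rewrite -ltnS.
transitivity ((-1) ^+ i * (-1) ^+ i * ('C(n, i)%:R * pochhammer eps i *
    pochhammer (- eps - w%:R) (n - i) / pochhammer lam n * H.[i%:R])).
  by field; rewrite rhoi lamn.
by rewrite -expr2 sqrr_sign mul1r.
Qed.

End MillerParisTransform.

(** * Power series with binomial coefficients *)

(** Conversion from the Bernstein basis to the monomial one. *)
Lemma bernstein_bin (A : comPzRingType) (x : A) M l :
  \sum_(k < M.+1) 'C(M, k)%:R * 'C(k, l)%:R * (x ^+ k * (1 - x) ^+ (M - k)) =
  'C(M, l)%:R * x ^+ l.
Proof.
have [lelM|ltMl] := leqP l M; last first.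
  rewrite (bin_small ltMl) mul0r big1 // => k _.
  by rewrite (@bin_small k) ?mulr0 ?mul0r // (leq_trans (ltn_ord k)).
rewrite -(big_mkord xpredT (fun k : nat =>
  'C(M, k)%:R * 'C(k, l)%:R * (x ^+ k * (1 - x) ^+ (M - k)))).
rewrite (big_cat_nat (n := l)) ?leqW //= big1_seq ?add0r; last first.
  move=> k /andP[_]; rewrite mem_index_iota => /andP[_ ?].
  by rewrite (bin_small (n := k)) // mulr0 mul0r.
rewrite -{1}[l]add0n big_addn subSn // big_mkord.
transitivity ('C(M, l)%:R * x ^+ l * (1 - x + x) ^+ (M - l)); last first.
  by rewrite subrK expr1n mulr1.
rewrite exprDn mulr_sumr.
apply: eq_bigr => i _.
rewrite -natrM bin_trinomial // natrM -mulr_natr (addnC i) exprD -subnDA; ring.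
Qed.

Lemma poly_eq_natr (F : numFieldType) n (p q : {poly F}) :
  (size p <= n)%N -> (size q <= n)%N ->
  (forall k, (k < n)%N -> p.[k%:R] = q.[k%:R]) -> p = q.
Proof.
move=> sp sq pq; apply/eqP; rewrite -subr_eq0; apply/negPn/negP => r0.
pose s := [seq i%:R : F | i <- iota 0 n].
have rs : all (root (p - q)) s.
  apply/allP => _ /mapP[i + ->]; rewrite mem_iota => /andP[_ ltin].
  by apply/rootP; rewrite hornerD hornerN pq ?subrr.
have us : uniq s.
  by rewrite map_inj_uniq ?iota_uniq // => i j /eqP; rewrite eqr_nat => /eqP.
have := max_poly_roots r0 rs us; rewrite size_map size_iota ltnNge.
by rewrite (leq_trans (size_polyD _ _)) // size_polyN geq_max sp.
Qed.

Section Analysis.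
Variable R : realType.
Local Open Scope classical_set_scope.

Lemma oneB_neq0 (x : R) : `|x| < 1 -> 1 - x != 0.
Proof.
by rewrite subr_eq0; apply: contraTneq => <-; rewrite normr1 ltxx.
Qed.

Lemma poly_eq_ball (p q : {poly R}) :
  (forall x, `|x| < 1 -> p.[x] = q.[x]) -> p = q.
Proof.
move=> pq; apply/eqP; rewrite -subr_eq0; apply/negPn/negP => r0.
pose s := [seq (i.+2)%:R^-1 : R | i <- iota 0 (size (p - q))].
have rs : all (root (p - q)) s.
  apply/allP => _ /mapP[i _ ->]; apply/rootP; rewrite hornerD hornerN pq ?subrr //.
  by rewrite ger0_norm ?invr_ge0 // invf_lt1 ?ltr1n.
have us : uniq s.
  rewrite map_inj_uniq ?iota_uniq // => i j /invr_inj/eqP.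
  by rewrite eqr_nat => /eqP[].
by have := max_poly_roots r0 rs us; rewrite size_map size_iota ltnn.
Qed.

(** Partial sums of [\sum_i 'C(i, N) * x ^+ i] by summation by parts. *)
Lemma series_binS (x : R) N n :
  (1 - x) * series (fun i => 'C(i, N.+1)%:R * x ^+ i) n =
  x * series (fun i => 'C(i, N)%:R * x ^+ i) n - 'C(n, N.+1)%:R * x ^+ n.
Proof.
rewrite !seriesEnat /=; elim: n => [|n IHn].
  by rewrite !big_geq // bin0n mul0r !mulr0 subr0.
by rewrite !big_nat_recr //= mulrDr IHn binS natrD exprS; ring.
Qed.

Lemma series_bin0 (x : R) n :
  (1 - x) * series (fun i => 'C(i, 0)%:R * x ^+ i) n = 1 - x ^+ n.
Proof.
rewrite !seriesEnat /=; elim: n => [|n IHn]; first by rewrite !big_geq // subrr mulr0.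
by rewrite !big_nat_recr //= mulrDr IHn bin0 exprS; ring.
Qed.

(** The terms tend to 0 because the partial sums at [`|x|] are bounded,
    uniformly in [n]. *)
Lemma cvg_bin_expr (x : R) N : `|x| < 1 ->
  (fun n => 'C(n, N)%:R * x ^+ n) @ \oo --> (0 : R).
Proof.
move=> x1; apply: norm_cvg0.
under eq_fun do rewrite normrM normrX normr_nat.
have x1' : 0 < 1 - `|x| by rewrite subr_gt0.
have bnd n : series (fun i => 'C(i, N)%:R * `|x| ^+ i) n <=
             `|x| ^+ N / (1 - `|x|) ^+ N.+1.
  elim: N => [|N IHN].
    rewrite expr0 expr1 ler_pdivlMr // mulrC series_bin0 gerBl exprn_ge0 //.
  rewrite exprS (exprS _ N.+1) ler_pdivlMr ?mulr_gt0 ?exprn_gt0 //.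
  rewrite mulrA (mulrC _ (1 - _)) series_binS.
  apply: le_trans (_ : `|x| * series (fun i => 'C(i, N)%:R * `|x| ^+ i) n
    * (1 - `|x|) ^+ N.+1 <= _).
    by rewrite ler_pM2r ?exprn_gt0 // gerBl mulr_ge0 ?exprn_ge0.
  by rewrite -mulrA ler_wpM2l // -ler_pdivlMr ?exprn_gt0.
apply: cvg_series_cvg_0; apply: nondecreasing_is_cvgn.
  by apply: nondecreasing_series => n _ _; rewrite mulr_ge0 ?exprn_ge0.
by exists (`|x| ^+ N / (1 - `|x|) ^+ N.+1) => _ [n _ <-].
Qed.

Lemma cvg_series_bin (x : R) a k : `|x| < 1 ->
  series (fun n => 'C(n + a, a + k)%:R * x ^+ n) @ \oo -->
  x ^+ k / (1 - x) ^+ (a + k).+1.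
Proof.
move=> x1; have x0 := oneB_neq0 x1.
elim: a k => [|a IHa] k.
  (* Without shift, pass to the limit in the formula for partial sums. *)
  under eq_fun do rewrite addn0 add0n.
  rewrite add0n; elim: k => [|k IHk].
    have -> : series (fun i => 'C(i, 0)%:R * x ^+ i) =
        (fun n => (1 - 'C(n, 0)%:R * x ^+ n) / (1 - x)).
      by apply/funext => n; rewrite bin0 mul1r -series_bin0 mulrC mulKf.
    rewrite expr0 expr1 -[X in X / _](subr0 1).
    by apply: cvgM (cvg_cst _); apply: cvgB (cvg_cst _) (cvg_bin_expr _ x1).
  have -> : series (fun i => 'C(i, k.+1)%:R * x ^+ i) =
     (fun n => (x * series (fun i => 'C(i, k)%:R * x ^+ i) n
                 - 'C(n, k.+1)%:R * x ^+ n)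
      / (1 - x)).
    by apply/funext => n; rewrite -series_binS mulrC mulKf.
  have -> : x ^+ k.+1 / (1 - x) ^+ k.+2 =
            (x * (x ^+ k / (1 - x) ^+ k.+1) - 0) / (1 - x).
    by rewrite !exprS; field; rewrite x0 expf_neq0.
  apply: cvgM (cvg_cst _); apply: cvgB (cvg_bin_expr _ x1).
  by apply: cvgM IHk; apply: cvg_cst.
(* Pascal's rule increases the shift. *)
have -> : series (fun n => 'C(n + a.+1, a.+1 + k)%:R * x ^+ n) =
  series (fun n => 'C(n + a, a + k.+1)%:R * x ^+ n) \+
  series (fun n => 'C(n + a, a + k)%:R * x ^+ n).
  apply/funext => n; rewrite /= !seriesEnat /= -big_split /=; apply: eq_bigr => i _.
  by rewrite addnS addSn binS natrD mulrDl addnS.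
have -> : x ^+ k / (1 - x) ^+ (a.+1 + k).+1 =
   x ^+ k.+1 / (1 - x) ^+ (a + k.+1).+1 + x ^+ k / (1 - x) ^+ (a + k).+1.
  by rewrite addSn addnS !exprS; field; rewrite x0 expf_neq0.
by apply: cvgD; apply: IHa.
Qed.

(** * The generalized Euler transformation *)

Section Euler.
Variables (a M w : nat) (eps rho : R) (H : {poly R}).
Hypotheses (sH : (size H <= w.+1)%N) (epsM : rho - eps - w%:R = - M%:R).
Hypotheses (wM : (w <= M)%N).
Hypothesis delta0 : pochhammer (rho - a.+1%:R - w%:R) w != 0.
Hypothesis rho0 : forall n, pochhammer rho n != 0.

(** The generalized Euler transformation for [delta = a + 1] and
    [rho - eps - w = - M]. The right-hand side is then a finite sum, and the
    exponent [rho - delta - eps - w] is [- (a + 1 + M)]. *)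
Lemma euler_transformation x : `|x| < 1 ->
  series (fun n => pochhammer a.+1%:R n * pochhammer eps n
     / (pochhammer rho n * n`!%:R) * H.[n%:R] * x ^+ n) @ \oo -->
  (\sum_(l < M.+1) pochhammer (- M%:R) l * pochhammer (rho - a.+1%:R - w%:R) l
     / (pochhammer rho l * l`!%:R) * (miller_paris2 w a.+1%:R eps rho H).[l%:R]
     * x ^+ l) / (1 - x) ^+ (a.+1 + M).
Proof.
move=> x1; have x0 := oneB_neq0 x1.
have fact0 k : k`!%:R != 0 :> R by rewrite pnatr_eq0 -lt0n fact_gt0.
set G := miller_paris1 w eps rho H.
have sG : (size G <= w.+1)%N by apply: size_miller_paris1.
rewrite /miller_paris2 -/G; set Q := miller_paris1 w a.+1%:R rho G.
pose c k := pochhammer (- M%:R) k / pochhammer rho k * G.[k%:R].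
pose e k := pochhammer (rho - a.+1%:R - w%:R) k / pochhammer rho k * Q.[k%:R].
have Bc n : binomial_transform c n =
    pochhammer eps n / pochhammer rho n * H.[n%:R].
  rewrite -[RHS](binomial_transformK
    (fun n => pochhammer eps n / pochhammer rho n * H.[n%:R])).
  apply: eq_binomial_transform => k _.
  by rewrite -(@miller_paris1_transform _ w) ?epsM // pochhammerN_neq0.
have Be n : binomial_transform e n =
    pochhammer a.+1%:R n / pochhammer rho n * G.[n%:R].
  rewrite -[RHS](binomial_transformK
    (fun n => pochhammer a.+1%:R n / pochhammer rho n * G.[n%:R])).
  by apply: eq_binomial_transform => k _; rewrite -(@miller_paris1_transform _ w).
(* The sum stops at M, whatever n, as (- M)_k is a factor of c k. *)
have BcM n : binomial_transform c n =
    \sum_(k < M.+1) (-1) ^+ k * 'C(n, k)%:R * c k.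
  rewrite (@binomial_transform_widen _ (M.+1 + n)) ?addSn ?ltnS ?leq_addl //.
  rewrite -addSn big_split_ord /= [X in _ + X]big1 ?addr0 // => i _.
  by rewrite /c pochhammerN (bin_small (leq_addr _ _)); ring.
have -> : (fun n => pochhammer a.+1%:R n * pochhammer eps n
     / (pochhammer rho n * n`!%:R) * H.[n%:R] * x ^+ n) =
   (fun n => \sum_(k < M.+1) (-1) ^+ k * 'C(k + a, a)%:R * c k *
               ('C(n + a, a + k)%:R * x ^+ n)).
  apply/funext => n.
  transitivity ('C(n + a, a)%:R * binomial_transform c n * x ^+ n).
    by rewrite Bc pochhammer_natS; field; rewrite rho0 fact0.
  rewrite BcM mulr_sumr mulr_suml; apply: eq_bigr => k _.
  have := bin_trinomial k (leq_addl n a).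
  rewrite addnK => /(congr1 (fun n => n%:R : R)).
  by rewrite !natrM (addnC a) => tri; ring: tri.
have -> : series (fun n => \sum_(k < M.+1) (-1) ^+ k * 'C(k + a, a)%:R * c k *
                             ('C(n + a, a + k)%:R * x ^+ n)) =
  (fun n => \sum_(k < M.+1) (-1) ^+ k * 'C(k + a, a)%:R * c k *
              series (fun n => 'C(n + a, a + k)%:R * x ^+ n) n).
  apply/funext => n; rewrite seriesEnat /= exchange_big /=; apply: eq_bigr => k _.
  by rewrite seriesEnat /= mulr_sumr.
(* Both sides are the same combination of Bernstein polynomials, with
   coefficients B e. *)
have -> : (\sum_(l < M.+1)
     pochhammer (- M%:R) l * pochhammer (rho - a.+1%:R - w%:R) l
     / (pochhammer rho l * l`!%:R) * Q.[l%:R] * x ^+ l) / (1 - x) ^+ (a.+1 + M) =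
   \sum_(k < M.+1) (-1) ^+ k * 'C(k + a, a)%:R * c k *
     (x ^+ k / (1 - x) ^+ (a + k).+1).
  transitivity ((\sum_(k < M.+1)
      'C(M, k)%:R * (x ^+ k * (1 - x) ^+ (M - k)) * binomial_transform e k)
     / (1 - x) ^+ (a.+1 + M)).
    congr (_ / _).
    transitivity (\sum_(l < M.+1) (-1) ^+ l * e l *
      (\sum_(k < M.+1)
         'C(M, k)%:R * 'C(k, l)%:R * (x ^+ k * (1 - x) ^+ (M - k)))).
      apply: eq_bigr => l _; rewrite bernstein_bin /e pochhammerN.
      by field; rewrite rho0 fact0.
    under eq_bigr do rewrite mulr_sumr.
    rewrite exchange_big /=; apply: eq_bigr => k _.
    rewrite (@binomial_transform_widen _ M.+1) // mulr_sumr.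
    by apply: eq_bigr => l _; ring.
  rewrite mulr_suml; apply: eq_bigr => k _.
  have kM : (k <= M)%N by rewrite -ltnS.
  rewrite Be /c pochhammerN pochhammer_natS.
  have -> : (1 - x) ^+ (a.+1 + M) = (1 - x) ^+ (a + k).+1 * (1 - x) ^+ (M - k).
    by rewrite -exprD; congr (_ ^+ _); lia.
  (* The product of the two signs is 1. *)
  transitivity ((-1) ^+ k * (-1) ^+ k *
    ('C(M, k)%:R * 'C(k + a, a)%:R * k`!%:R * x ^+ k * G.[k%:R]
     / (pochhammer rho k * (1 - x) ^+ (a + k).+1))).
    by rewrite -expr2 sqrr_sign; field; rewrite rho0 !expf_neq0.
  by field; rewrite rho0 expf_neq0.
apply: cvg_big => [|k _]; first exact: add_continuous.
by apply: cvgM; [apply: cvg_cst|apply: cvg_series_bin].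
Qed.

End Euler.
End Analysis.

(** * The d-Narayana polynomial *)

(** Throughout, [d = e + 2] and [m = p + 1]. *)

Section NarayanaH.
Variables (F : numFieldType) (e p : nat).

(** The parameters other than [m + 1], [m + d] and 2 contribute [H(n)] to the
    n-th coefficient, since
    [(m + i - 1)_n / (i)_n = (i + n)_(m - 1) / (i)_(m - 1)]. *)
Lemma narayana_H_ratio n :
  (\prod_(i <- iota 2 e) pochhammer (p.+1 + i)%:R n)
   / \prod_(i <- iota 3 e) pochhammer i%:R n =
  (narayana_H F e.+2 p.+1).[n%:R].
Proof.
rewrite /narayana_H hornerZ horner_prod /index_iota !subSS subn0 mulrC [RHS]mulrC.
rewrite (iotaDl 1 2 e) !big_map [LHS]mulrC -!prodf_div; apply: eq_bigr => i _ /=.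
rewrite horner_pochhammer hornerD hornerC hornerX.
have pos k : pochhammer (1 + i)%:R k != 0 :> F.
  by rewrite lt0r_neq0 // pochhammer_gt0 ?ltr0n.
apply/eqP; rewrite eqr_div //; apply/eqP; rewrite mulrC [RHS]mulrC.
rewrite (_ : (p.+1 + i)%:R = (1 + i)%:R + p%:R :> F); last first.
  by rewrite -natrD; congr _%:R; lia.
by rewrite -!pochhammerD (addnC p).
Qed.

Lemma size_narayana_H : (size (narayana_H F e.+2 p.+1) <= (e * p).+1)%N.
Proof.
rewrite /narayana_H (leq_trans (size_scale_leq _ _)) // /index_iota !subSS subn0 /=.
elim: e 3%N => [|e' IHe] k; first by rewrite big_nil size_poly1.
rewrite /= big_cons (leq_trans (size_polyMleq _ _)) //.
have : (size (pochhammer ((k%:R : F)%:P + 'X)%R p) <= p.+1)%N.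
  by apply: size_pochhammer; rewrite addrC size_XaddC.
have := IHe k.+1; rewrite mulSn; set a := size _; set b := size _; lia.
Qed.

End NarayanaH.

Section Narayana.
Variables (R : realType) (e p : nat).
Local Notation M := (e.+1 * p.+1)%N.
Local Notation K := (e.+1 * p)%N.
Local Notation L := (e * p)%N.
Local Notation H := (narayana_H R e.+2 p.+1).
Local Notation Q := (miller_paris2 L (p.+1 + 1)%:R (p.+1 + e.+2)%:R 2%:R H).
Local Open Scope classical_set_scope.

Let rho0 n : pochhammer (2%:R : R) n != 0.
Proof. by rewrite lt0r_neq0 // pochhammer_gt0 ?ltr0n. Qed.

Let lamM : 2%:R - (p.+1 + e.+2)%:R - L%:R = - M%:R :> R.
Proof.
by apply/eqP; rewrite -subr_eq0 !natrM -!natr1 !natrD -!natr1; apply/eqP; ring.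
Qed.

Let lamK : 2%:R - (p.+1 + 1)%:R - L%:R = - K%:R :> R.
Proof.
by apply/eqP; rewrite -subr_eq0 !natrM -!natr1 !natrD -!natr1; apply/eqP; ring.
Qed.

Let leLK : (L <= K)%N. Proof. by rewrite leq_mul2r leqnSn orbT. Qed.
Let leKM : (K <= M)%N. Proof. by rewrite leq_mul2l leqnSn orbT. Qed.

(** The coefficients of the numerator in the Euler transformation for the
    parameters at hand, as a function of the transformed polynomial [q]. *)
Definition narayana_coef (q : {poly R}) l : R :=
  pochhammer (- M%:R) l * pochhammer (- K%:R) l
     / (pochhammer 2%:R l * l`!%:R) * q.[l%:R].

(** Uses [(2)_l = (l + 1)!] and
    [(K + 1) * 'C(K, l) = (l + 1) * 'C(K + 1, l + 1)]. *)
Lemma narayana_coefE q l : narayana_coef q l =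
  (K + 1)%:R^-1 * ('C(M, l)%:R * 'C(K + 1, l + 1)%:R * q.[l%:R]).
Proof.
rewrite /narayana_coef !pochhammerN (pochhammer_natS R 1) bin1 !addn1.
have := mul_bin_diag K.+1 l => /(congr1 (fun n => n%:R : R)).
rewrite !natrM => diag.
have l0 : l.+1%:R != 0 :> R by rewrite pnatr_eq0.
have K0 : K.+1%:R != 0 :> R by rewrite pnatr_eq0.
have f0 : l`!%:R != 0 :> R by rewrite pnatr_eq0 -lt0n fact_gt0.
transitivity ((-1) ^+ l * (-1) ^+ l * 'C(M, l)%:R * q.[l%:R]
              * ('C(K, l)%:R / l.+1%:R)).
  by field; rewrite f0 addrC natr1 l0.
rewrite -expr2 sqrr_sign mul1r.
have -> : 'C(K, l)%:R / l.+1%:R = 'C(K.+1, l.+1)%:R / K.+1%:R :> R.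
  by apply/eqP; rewrite eqr_div // mulrC diag mulrC.
by ring.
Qed.

Lemma narayana_euler x : `|x| < 1 ->
  series (fun n => pochhammer (p.+1 + 1)%:R n * pochhammer (p.+1 + e.+2)%:R n
     / (pochhammer 2%:R n * n`!%:R) * H.[n%:R] * x ^+ n) @ \oo -->
  (\poly_(l < K.+1) narayana_coef Q l).[x] / (1 - x) ^+ (p.+1 * e.+2 + 1).
Proof.
move=> x1; rewrite horner_poly.
(* The parameter - K cuts the sum off at K, which is at most M. *)
have -> : \sum_(l < K.+1) narayana_coef Q l * x ^+ l =
          \sum_(l < M.+1) narayana_coef Q l * x ^+ l.
  rewrite (big_ord_widen M.+1 (fun l => narayana_coef Q l * x ^+ l)) ?ltnS //.
  rewrite big_mkcond /=; apply: eq_bigr => l _; case: ltnP => // ltKl.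
  by rewrite /narayana_coef (pochhammerN _ K) bin_small //; ring.
have := @euler_transformation R p.+1 M L (p.+1 + e.+2)%:R 2%:R H
  (size_narayana_H R e p) lamM (leq_trans leLK leKM) _ rho0 x x1.
rewrite -(addn1 p.+1) lamK pochhammerN_neq0 => /(_ leLK).
rewrite (_ : (p.+1 + 1 + M)%N = (p.+1 * e.+2 + 1)%N); last by lia.
by [].
Qed.

(** The same series, with the roles of [m + 1] and [m + d] exchanged. *)
Lemma narayana_euler_sym x : `|x| < 1 ->
  series (fun n => pochhammer (p.+1 + 1)%:R n * pochhammer (p.+1 + e.+2)%:R n
     / (pochhammer 2%:R n * n`!%:R) * H.[n%:R] * x ^+ n) @ \oo -->
  (\poly_(l < K.+1) narayana_coef
     (miller_paris2 L (p.+1 + e.+2)%:R (p.+1 + 1)%:R 2%:R H) l).[x]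
  / (1 - x) ^+ (p.+1 * e.+2 + 1).
Proof.
move=> x1; rewrite horner_poly.
have := @euler_transformation R (p + e.+2) K L (p.+1 + 1)%:R 2%:R H
  (size_narayana_H R e p) lamK leLK _ rho0 x x1.
rewrite -addSn lamM pochhammerN_neq0 => /(_ (leq_trans leLK leKM)).
rewrite (_ : (p.+1 + e.+2 + K)%N = (p.+1 * e.+2 + 1)%N); last by lia.
under eq_fun do rewrite [pochhammer (p.+1 + e.+2)%:R _ * _]mulrC.
by under eq_bigr do rewrite [pochhammer (- K%:R) _ * _]mulrC.
Qed.

(** The operators [T_L(m + 1; 2)] and [T_L(m + d; 2)] commute on [H]: the two
    transformations share their left-hand side, so both polynomials have the
    same values at 0, ..., K, and their degrees are at most L <= K. *)
Lemma narayana_miller_paris2C :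
  Q = miller_paris2 L (p.+1 + e.+2)%:R (p.+1 + 1)%:R 2%:R H.
Proof.
set Q' := RHS.
have PQ : \poly_(l < K.+1) narayana_coef Q l =
          \poly_(l < K.+1) narayana_coef Q' l.
  apply: poly_eq_ball => x x1; have x0 := oneB_neq0 x1.
  have := cvg_lim (@norm_hausdorff _ _) (narayana_euler x1).
  rewrite (cvg_lim (@norm_hausdorff _ _) (narayana_euler_sym x1)).
  move=> h.
  by apply: (mulIf (invr_neq0 (expf_neq0 (p.+1 * e.+2 + 1) x0))); rewrite h.
apply: (@poly_eq_natr _ K.+1); try exact: leq_trans (size_miller_paris1 _ _ _ _) _.
move=> l ltlK; have /(congr1 (fun q : {poly R} => q`_l)) := PQ.
rewrite !coef_poly ltlK !narayana_coefE => /mulfI.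
rewrite invr_eq0 pnatr_eq0 addn1 /= => /(_ isT) /mulfI; apply.
rewrite mulf_neq0 // pnatr_eq0 -lt0n bin_gt0 ?addn1 ?ltnS //.
by rewrite (leq_trans _ leKM) // -ltnS.
Qed.

Lemma hyper_coef_narayana n :
  hyper_coef [seq (p.+1 + i)%:R | i <- iota 1 e.+2]
             [seq i%:R : R | i <- iota 2 e.+1] n =
  pochhammer (p.+1 + 1)%:R n * pochhammer (p.+1 + e.+2)%:R n
     / (pochhammer 2%:R n * n`!%:R) * H.[n%:R].
Proof.
have -> : iota 1 e.+2 = (1 :: iota 2 e ++ [:: e.+2])%N.
  have <- : iota 2 (e + 1) = iota 2 e ++ [:: e.+2] by rewrite iotaD.
  by rewrite addn1.
rewrite /hyper_coef !big_map !big_cons big_cat big_seq1 -narayana_H_ratio /=.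
by rewrite !invfM; ring.
Qed.

Lemma is_narayanaP N :
  is_narayana e.+2 p.+1 N <-> N = \poly_(l < K.+1) narayana_coef Q l.
Proof.
have hyp x : `|x| < 1 ->
  hypergeometric [seq (p.+1 + i)%:R | i <- iota 1 e.+2]
                 [seq i%:R : R | i <- iota 2 e.+1] x =
  (\poly_(l < K.+1) narayana_coef Q l).[x] / (1 - x) ^+ (p.+1 * e.+2 + 1).
  move=> x1; rewrite /hypergeometric; under eq_fun do rewrite hyper_coef_narayana.
  exact: cvg_lim (narayana_euler x1).
split=> [Nnar|-> x]; last exact: hyp.
apply: poly_eq_ball => x x1; have x0 := oneB_neq0 x1.
have := Nnar x x1; rewrite hyp // => h.
by apply: (mulIf (invr_neq0 (expf_neq0 (p.+1 * e.+2 + 1) x0))); rewrite h.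
Qed.

Lemma hypergeometric1_terminating j :
  hypergeometric
     (- j%:R :: [seq (p.+1 + i)%:R | i <- iota 1 e.+1])
     (K%:R + 3%:R - j%:R :: [seq i%:R : R | i <- iota 3 e]) 1 =
  \sum_(i < j.+1) pochhammer (- j%:R) i * pochhammer (p.+1 + 1)%:R i
    / (pochhammer (K%:R + 3%:R - j%:R) i * i`!%:R) * H.[i%:R].
Proof.
rewrite /hypergeometric; apply: cvg_lim; first exact: norm_hausdorff.
(* The partial sums are constant beyond j. *)
apply: cvg_near_cst; exists j.+1 => // n /= ltjn.
rewrite seriesEnat /= big_mkord -(subnKC ltjn) big_split_ord /=.
rewrite [X in _ + X]big1 ?addr0 => [|i _].
  apply: eq_bigr => i _; rewrite expr1n mulr1 /hyper_coef !big_cons !big_map.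
  rewrite -narayana_H_ratio.
  by rewrite !invfM; ring.
rewrite /hyper_coef big_cons pochhammerN bin_small ?leq_addr //.
by rewrite mulr0 !mul0r.
Qed.

(** The operator with parameter [m + d] is taken as the outer one. *)
Lemma miller_paris2_explicit t :
  Q.[t] =
     \sum_(j < L.+1)
       (pochhammer (p.+1 + e.+2)%:R j * pochhammer (- K%:R - 2%:R) j
         * pochhammer (- t) j * pochhammer (t - M%:R) (L - j))
       / ((-1) ^+ j * pochhammer (- M%:R) L * pochhammer (- K%:R) j * j`!%:R)
       * hypergeometric
           (- j%:R :: [seq (p.+1 + i)%:R | i <- iota 1 e.+1])
           (K%:R + 3%:R - j%:R :: [seq i%:R | i <- iota 3 e]) 1.
Proof.
rewrite narayana_miller_paris2C miller_paris1_sum lamM (addrC (- M%:R)).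
apply: eq_bigr => j _; have lejL : (j <= L)%N by rewrite -ltnS.
have lejK := leq_trans lejL leLK.
rewrite transform_miller_paris1 ?lamK ?pochhammerN_neq0 //; last first.
  exact: size_narayana_H.
rewrite hypergeometric1_terminating !mulr_sumr; apply: eq_bigr => i _.
have leij : (i <= j)%N by rewrite -ltnS.
rewrite (_ : - (p.+1 + 1)%:R - L%:R = - K%:R - 2%:R); last first.
  by rewrite -lamK; ring.
have f0 k : k`!%:R != 0 :> R by rewrite pnatr_eq0 -lt0n fact_gt0.
have c0 : pochhammer (K%:R + 3%:R - j%:R : R) i != 0.
  apply/lt0r_neq0/pochhammer_gt0.
  by rewrite -natrD -natrB ?ltr0n; lia.
(* Reversing the last i factors of (- K - 2)_j. *)
have refl : pochhammer (- K%:R - 2%:R) j = pochhammer (- K%:R - 2%:R) (j - i) *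
    ((-1) ^+ i * pochhammer (K%:R + 3%:R - j%:R) i) :> R.
  rewrite -{1}(subnK leij) pochhammerD; congr (_ * _).
  by rewrite pochhammer_reflect natrB //; congr (_ * pochhammer _ _); ring.
have Mn0 : pochhammer (- M%:R : R) L != 0.
  by rewrite pochhammerN_neq0 (leq_trans leLK).
have Kn0 : pochhammer (- K%:R : R) j != 0 by rewrite pochhammerN_neq0.
rewrite refl (pochhammerN _ j i) !invfM invr_sign.
transitivity ((-1) ^+ i * (-1) ^+ i *
  ((-1) ^+ j * pochhammer (p.+1 + e.+2)%:R j * pochhammer (- t) j *
  pochhammer (t - M%:R) (L - j) * (j`!%:R^-1 / pochhammer (- M%:R) L) *
  ('C(j, i)%:R * pochhammer (p.+1 + 1)%:R i *
   pochhammer (- K%:R - 2%:R) (j - i) / pochhammer (- K%:R) j * H.[i%:R]))).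
  by rewrite -expr2 sqrr_sign mul1r.
by field; rewrite !f0 c0 Mn0 Kn0.
Qed.

End Narayana.

Theorem theorem5 (R : realType) (d m : nat) (hd : (2 <= d)%N) (hm : (1 <= m)%N) :
  let M := ((d - 1) * m)%N in
  let K := ((d - 1) * (m - 1))%N in
  let L := ((d - 2) * (m - 1))%N in
  let Q : {poly R} :=
    miller_paris2 L (m + 1)%:R (m + d)%:R 2%:R (narayana_H R d m) in
  (forall N : {poly R},
     is_narayana d m N <->
     N = (K + 1)%:R^-1 *:
         \sum_(j < K.+1) ('C(M, j)%:R * 'C(K + 1, j + 1)%:R * Q.[j%:R]) *: 'X^j)
  /\
  (forall t : R,
     Q.[t] =
     \sum_(j < L.+1)
       (pochhammer (m + d)%:R j * pochhammer (- K%:R - 2%:R) j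
         * pochhammer (- t) j * pochhammer (t - M%:R) (L - j))
       / ((-1) ^+ j * pochhammer (- M%:R) L * pochhammer (- K%:R) j * j`!%:R)
       * hypergeometric
           (- j%:R :: [seq (m + i)%:R | i <- iota 1 (d - 1)])
           (K%:R + 3%:R - j%:R :: [seq i%:R | i <- iota 3 (d - 2)]) 1).
Proof.
case: d hd => [|[|e]] // _; case: m hm => [|p] // _.
rewrite !subSS !subn0; split=> [N|t]; last exact: miller_paris2_explicit.
rewrite is_narayanaP poly_def scaler_sumr.
by under [X in _ = X <-> _]eq_bigr do rewrite narayana_coefE -scalerA.
Qed.
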